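(* Let $\{j_n\}_{n\ge1}$ be a sequence of positive integers with $j_n\le n$ and $j_n=o(n^{1/6})$ as $n\to\infty$. Then the last $j_n$ cars from among the $n$ cars park in increasing order with probability approaching 1 as $n\to\infty$: $$\lim_{n\to\infty}P_n^{\text{park}}\left(\sigma^{-1}_{n+1-j_n}<\sigma^{-1}_{n+1-j_n+1}<\cdots<\sigma^{-1}_n\right)=1.$$
   Context: $[n]=\{1,\dots,n\}$ and $S_n$ is the set of permutations $\sigma=\sigma_1\cdots\sigma_n$ of $[n]$; $\sigma^{-1}_k=j$ if and only if $\sigma_j=k$. Parking: cars $1,\dots,n$ arrive in this order on a one-way street with spaces $1,\dots,n$; given a sequence $\pi=(\pi_1,\dots,\pi_n)\in[n]^n$ of preferred spaces, car $i$ parks in space $\pi_i$ if it is free, and otherwise in the first free space with number greater than $\pi_i$, if one exists (if none exists the car exits the street). $\pi$ is a parking function on $[n]$ if all $n$ cars are able to park; $\mathcal{P}_n$ is the set of parking functions on $[n]$. The map $T_n:\mathcal{P}_n\to S_n$ is $T_n(\pi)=\sigma$, where $\sigma_j$ is the number of the car that parked in space $j$, $j\in[n]$. The probability measure $P_n^{\text{park}}$ on $S_n$ is $P_n^{\text{park}}(\sigma)=|T_n^{-1}(\{\sigma\})|/|\mathcal{P}_n|$. *)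

(* Defs.v *)
From HB Require Import structures.
From mathcomp Require Import all_boot all_order all_algebra all_fingroup.
From mathcomp Require Import all_classical all_reals all_analysis.

Set Implicit Arguments.
Unset Strict Implicit.
Unset Printing Implicit Defensive.

Import Order.TTheory GRing.Theory Num.Theory.
Import numFieldNormedType.Exports.

Local Open Scope ring_scope.

(* Cars and spaces are both numbered from 0, as elements of 'I_n: the car and
   the space numbered k + 1 in the usual convention are the ordinal k. *)

(* [occ q] is the car parked in space [q], or [None] if [q] is free. *)
Definition occupancy (n : nat) := {ffun 'I_n -> option 'I_n}.

(* [None] means that the car exits the street.  [enum 'I_n] is increasing, so
   [ohead] returns the smallest free space. *)
Definition space_for (n : nat) (occ : occupancy n) (p : 'I_n) : option 'I_n :=
  if occ p == None then Some p
  else ohead [seq q : 'I_n <- enum 'I_n | (p < q)%N && (occ q == None)].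

Definition park_car (n : nat) (pref : {ffun 'I_n -> 'I_n})
    (occ : occupancy n) (i : 'I_n) : occupancy n :=
  if space_for occ (pref i) is Some q
  then [ffun r => if r == q then Some i else occ r]
  else occ.

Definition final_occupancy (n : nat) (pref : {ffun 'I_n -> 'I_n}) : occupancy n :=
  foldl (park_car pref) [ffun=> None] (enum 'I_n).

Definition parking_functions (n : nat) : {set {ffun 'I_n -> 'I_n}} :=
  [set pref : {ffun 'I_n -> 'I_n} |
    [forall i, exists q, final_occupancy pref q == Some i]].

Lemma parking_outcome_ex (n : nat) (pref : {ffun 'I_n -> 'I_n}) :
  pref \in parking_functions n ->
  exists s : 'S_n, [forall q, final_occupancy pref q == Some (s q)].
Proof.
rewrite inE => /forallP parked.
have spot i : exists q, final_occupancy pref q == Some i by exact/existsP.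
pose f i := xchoose (spot i).
have fP i : final_occupancy pref (f i) = Some i by exact/eqP/(xchooseP (spot i)).
have f_inj : injective f.
  by move=> i j eq_f; have := fP i; rewrite eq_f fP => -[].
exists (perm f_inj)^-1%g; apply/forallP => q; apply/eqP.
by rewrite -[in LHS](permKV (perm f_inj) q) permE fP.
Qed.

(* [parking_outcome pref q] is the car that parked in space [q]. *)
Definition parking_outcome (n : nat)
    (pref : {pref : {ffun 'I_n -> 'I_n} | pref \in parking_functions n}) : 'S_n :=
  xchoose (parking_outcome_ex (valP pref)).

Lemma parking_outcomeP (n : nat)
    (pref : {pref : {ffun 'I_n -> 'I_n} | pref \in parking_functions n}) (q : 'I_n) :
  final_occupancy (val pref) q = Some (parking_outcome pref q).
Proof. by apply/eqP; move: q; apply/forallP/(xchooseP (parking_outcome_ex _)). Qed.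

Definition park_mass (R : realType) (n : nat) (s : 'S_n) : R :=
  #|@parking_outcome n @^-1: [set s]|%:R / #|parking_functions n|%:R.

Definition park_prob (R : realType) (n : nat) (A : {set 'S_n}) : R :=
  \sum_(s in A) park_mass R s.

(* [s^-1 k] is the space of car [k]; the last [j] cars are the ordinals
   [n - j, ..., n - 1]. *)
Definition last_cars_increasing (n j : nat) : {set 'S_n} :=
  [set s : 'S_n | [forall k : 'I_n, forall l : 'I_n,
     ((n - j <= k)%N && (l == k.+1 :> nat)) ==> (s^-1%g k < s^-1%g l)%N]].

(* Main.v *)
Require Import Defs.
From HB Require Import structures.
From mathcomp Require Import all_boot all_order all_algebra all_fingroup.
From mathcomp Require Import all_classical all_reals all_analysis.
From mathcomp Require Import zify ring lra.
Import Order.TTheory GRing.Theory Num.Theory.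
Import numFieldNormedType.Exports.

(** Write [N = n + 1].  If a car whose preference is at most the first free
    space parks, it takes that first free space, and all cars after it park
    further right.  So if the last [j] cars fail to be in increasing order, one
    of them skips the first free space: its preference lies strictly beyond it.
    The proof bounds the number of parking functions in which a given car [i]
    skips, and adds these bounds over the last [j] cars.

    Everything is counted among all [N ^ n] functions from the [n] cars to [N]
    spaces, the last of which is an overflow space.  The first free space left
    by a set [A] of cars does not depend on their order: it is determined by the
    counts of preferences below each threshold, and [head_size f A] is its
    number, counted from 1.  Two ingredients turn a skipping count into the mean
    of [head_size].

    The first is the cycle lemma.  Rotate cyclically the spaces from [b] to the
    overflow space.  If the first [b] spaces receive [b + r - 1] preferences, at
    most [r] of the rotations give a parking function
    ([card_parkable_swap_le]); for [b = 0] and [r = 1] at least one does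
    ([parkable_swap_ex]).  The latter gives at least [N ^ n / N] parking
    functions.  The former is applied with [b] the
    head size of the cars before [i]: when car [i] skips, the excess [r] is the
    number of later cars preferring one of the first [b] spaces, and averaging
    over rotations and over those later cars gives [card_skipping_le]: the
    number of parking functions in which [i] skips is at most
    [(n - 1 - i) / N ^ 2] times the sum of the head sizes of the cars before [i].

    The second is a recursion for the mean head size [E_m] of [m] cars: the head
    size is one more than the number of cars in the initial block, a car is in
    that block exactly when it prefers a space up to the first one left free by
    the others, and a preference is independent of the other cars.  Hence
    [E_m = 1 + (m / N) * E_(m-1)], which yields [E_m <= N / L + L] for every
    [L <= N] with [L > 0] ([sum_head_size_le]); of order [sqrt N] for the best [L].

    Together, the failure probability is at most [j ^ 2 * (1 / L + L / N)], which
    tends to 0 for [j = o(n ^ (1/6))] and [L] close to [sqrt n]. *)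

Set Implicit Arguments.
Unset Strict Implicit.
Unset Printing Implicit Defensive.

(** * The first free space of a set of cars *)

Definition count_below (n K : nat) (f : {ffun 'I_n -> 'I_K}) (A : {set 'I_n}) (t : nat) :=
  #|[set c in A | f c < t]|.

Lemma count_below_le_card (n K : nat) (f : {ffun 'I_n -> 'I_K}) (A : {set 'I_n}) (t : nat) :
  count_below f A t <= #|A|.
Proof. by apply/subset_leq_card/fintype.subsetP=> c; rewrite inE => /andP[]. Qed.

Lemma count_below_sum (n K : nat) (f : {ffun 'I_n -> 'I_K}) (A : {set 'I_n}) (t : nat) :
  count_below f A t = \sum_(c in A) (f c < t).
Proof.
rewrite /count_below -sum1_card big_mkcond [RHS]big_mkcond /=.
by apply: eq_bigr => c _; rewrite inE; case: (c \in A); case: (f c < t).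
Qed.

Lemma count_below_mono (n K : nat) (f : {ffun 'I_n -> 'I_K}) (A : {set 'I_n}) (t u : nat) :
  t <= u -> count_below f A t <= count_below f A u.
Proof.
move=> tu; apply/subset_leq_card/fintype.subsetP=> c; rewrite !inE => /andP[-> /=] ct.
exact: leq_trans ct tu.
Qed.

Lemma head_size_ex (n K : nat) (f : {ffun 'I_n -> 'I_K}) (A : {set 'I_n}) :
  exists b, count_below f A b < b.
Proof. by exists #|A|.+1; rewrite ltnS count_below_le_card. Qed.

(** The number, counted from 1, of the first space left free when the cars of
    [A] park, in any order, on a long enough street.  When fewer than [b]
    cars prefer one of the first [b] spaces, one of these stays free; for the
    least such [b] it is the last of them, and the others are filled. *)
Definition head_size (n K : nat) (f : {ffun 'I_n -> 'I_K}) (A : {set 'I_n}) :=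
  ex_minn (head_size_ex f A).

Lemma head_sizeP (n K : nat) (f : {ffun 'I_n -> 'I_K}) (A : {set 'I_n}) (b : nat) :
  reflect (count_below f A b < b /\ forall t, t < b -> t <= count_below f A t) (head_size f A == b).
Proof.
rewrite /head_size; case: ex_minnP => e e_lt e_min.
apply: (iffP eqP) => [<-|[b_lt b_min]].
  split=> // t te; rewrite leqNgt; apply/negP => /e_min; lia.
apply/eqP; rewrite eqn_leq e_min //= leqNgt; apply/negP => /b_min; lia.
Qed.

Lemma head_size_le (n K : nat) (f : {ffun 'I_n -> 'I_K}) (A : {set 'I_n}) (b : nat) :
  count_below f A b < b -> head_size f A <= b.
Proof. by rewrite /head_size; case: ex_minnP => e _; apply. Qed.

Lemma head_size_le_card (n K : nat) (f : {ffun 'I_n -> 'I_K}) (A : {set 'I_n}) :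
  head_size f A <= #|A|.+1.
Proof. by apply: head_size_le; rewrite ltnS count_below_le_card. Qed.

Lemma head_size_gt0 (n K : nat) (f : {ffun 'I_n -> 'I_K}) (A : {set 'I_n}) :
  0 < head_size f A.
Proof. by have /head_sizeP[] := eqxx (head_size f A); lia. Qed.

(** The cars with preference below the head size fill all the head but its last
    space: filling the spaces before takes at least that many cars, and one more
    would also fill the last. *)
Lemma count_below_head_size (n K : nat) (f : {ffun 'I_n -> 'I_K}) (A : {set 'I_n}) :
  (count_below f A (head_size f A)).+1 = head_size f A.
Proof.
have /head_sizeP[lt_e min_e] := eqxx (head_size f A).
have e_gt0 := head_size_gt0 f A.
have := min_e (head_size f A).-1 ltac:(lia).
have := @count_below_mono _ _ f A (head_size f A).-1 (head_size f A) ltac:(lia); lia.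
Qed.

(** Having head size [b] involves only the counts up to [b], so it survives any
    rearrangement of the spaces beyond. *)
Lemma head_size_local (n K : nat) (f g : {ffun 'I_n -> 'I_K}) (A B : {set 'I_n}) (b : nat) :
  (forall t, t <= b -> count_below f A t = count_below g B t) ->
  (head_size f A == b) = (head_size g B == b).
Proof.
move=> fg; apply/head_sizeP/head_sizeP => -[lt_b min_b].
  by rewrite -fg //; split=> // t tb; rewrite -fg; [exact: min_b | exact: ltnW].
by rewrite fg //; split=> // t tb; rewrite fg; [exact: min_b | exact: ltnW].
Qed.

(** * The mean head size *)

Definition redraw (I T : finType) (f : {ffun I -> T}) (c : I) (v : T) : {ffun I -> T} :=
  [ffun i => if i == c then v else f i].

(** The preference of [c] is independent of everything that does not look at it.
    Exchanging [f c] with an independent [v] is an involution on the pairs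
    [(f, v)]. *)
Lemma sum_resample (I T : finType) (c : I) (phi : {ffun I -> T} -> T -> nat) :
  (forall f v w, phi (redraw f c w) v = phi f v) ->
  #|T| * (\sum_f phi f (f c)) = \sum_f \sum_v phi f v.
Proof.
move=> phi_c.
pose h (p : {ffun I -> T} * T) := (redraw p.1 c p.2, p.1 c).
have hK : involutive h.
  move=> [f v]; rewrite /h /= ffunE eqxx; congr pair.
  by apply/ffunP => i; rewrite !ffunE; case: eqP => // ->.
rewrite -sum_nat_const exchange_big /= pair_bigA /= [RHS]pair_bigA /=.
rewrite (reindex_inj (inv_inj hK)) /=.
by apply: eq_bigr => -[f v] _ /=; rewrite phi_c ffunE eqxx.
Qed.

Lemma count_below_redraw (n K : nat) (f : {ffun 'I_n -> 'I_K}) (A : {set 'I_n}) c v t :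
  c \notin A -> count_below (redraw f c v) A t = count_below f A t.
Proof.
move=> cA; apply: eq_card => i; rewrite !inE ffunE.
by case: eqP => // ->; rewrite (negPf cA).
Qed.

Lemma head_size_redraw (n K : nat) (f : {ffun 'I_n -> 'I_K}) (A : {set 'I_n}) c v :
  c \notin A -> head_size (redraw f c v) A = head_size f A.
Proof.
move=> cA; apply/eqP; rewrite (@head_size_local _ _ _ f A A) // => t _.
exact: count_below_redraw.
Qed.

Lemma sum_ord_lt (K e : nat) : e <= K -> \sum_(v < K) (v < e) = e.
Proof.
move=> /minn_idPl {2}<-; elim: K => [|K IH]; first by rewrite big_ord0 minn0.
by rewrite big_ord_recr /= IH; lia.
Qed.

Lemma sum_ord_ge (K e : nat) : e <= K -> \sum_(v < K) (e <= v) = K - e.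
Proof.
move=> eK; apply: (@addnI e); rewrite subnKC // -{1}(sum_ord_lt eK) -big_split /=.
rewrite (eq_bigr (fun=> 1)) => [|v _]; last by case: (leqP e v).
by rewrite sum1_card card_ord.
Qed.

Lemma sum_lt_head_size (n : nat) (A : {set 'I_n}) (c : 'I_n) : c \notin A ->
  n.+1 * (\sum_(f : {ffun 'I_n -> 'I_n.+1}) (f c < head_size f A)) =
  \sum_(f : {ffun 'I_n -> 'I_n.+1}) head_size f A.
Proof.
move=> cA.
have := @sum_resample _ 'I_n.+1 c (fun f v => (v < head_size f A : nat)).
rewrite card_ord => ->; last by move=> f v w; rewrite head_size_redraw.
apply: eq_bigr => f _; apply: sum_ord_lt.
by rewrite (leq_trans (head_size_le_card f A)) // ltnS -[n in _ <= n]card_ord max_card.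
Qed.

(** Car [c] contributes only to the counts at thresholds beyond [f c].  If the
    other cars leave a head ending at or before [f c], then adding [c] does not
    change that head. *)
Lemma lt_head_size_remove (n K : nat) (f : {ffun 'I_n -> 'I_K}) (A : {set 'I_n}) c :
  f c < head_size f A -> f c < head_size f (A :\ c).
Proof.
move=> c_lt; rewrite ltnNge; apply/negP => le_c.
have E : count_below f A (head_size f (A :\ c)) = count_below f (A :\ c) (head_size f (A :\ c)).
  apply: eq_card => i; rewrite !inE; case: eqP => //= ->.
  by rewrite ltnNge le_c andbF.
have /head_size_le : count_below f A (head_size f (A :\ c)) < head_size f (A :\ c).
  by rewrite E -[X in _ < X]count_below_head_size.
by rewrite leqNgt (leq_ltn_trans le_c c_lt).
Qed.

(** The head size is one more than the number of cars in the initial block.  By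
    [lt_head_size_remove], membership of [c] is decided by the other cars and by
    an independent preference of [c]. *)
Lemma sum_head_size_rec (n : nat) (A : {set 'I_n}) :
  n.+1 * (\sum_(f : {ffun 'I_n -> 'I_n.+1}) head_size f A) <=
  n.+1 * n.+1 ^ n +
  \sum_(c in A) \sum_(f : {ffun 'I_n -> 'I_n.+1}) head_size f (A :\ c).
Proof.
have -> : \sum_(c in A) \sum_(f : {ffun 'I_n -> 'I_n.+1}) head_size f (A :\ c) =
    n.+1 * \sum_(c in A) \sum_(f : {ffun 'I_n -> 'I_n.+1}) (f c < head_size f (A :\ c)).
  by rewrite big_distrr /=; apply: eq_bigr => c _; rewrite sum_lt_head_size // !inE eqxx.
rewrite -mulnDr leq_mul2l /= exchange_big /=.
have -> : n.+1 ^ n = \sum_(f : {ffun 'I_n -> 'I_n.+1}) 1.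
  by rewrite sum1_card card_ffun !card_ord.
rewrite -big_split /=; apply: leq_sum => f _.
rewrite -[X in X <= _]count_below_head_size add1n ltnS count_below_sum; apply: leq_sum => c _.
have := @lt_head_size_remove _ _ f A c.
by case: (f c < _) => // ->.
Qed.

(** In terms of the mean head size [E_m] of [m] cars and [N = n + 1], the
    recursion reads [E_m <= 1 + (m / N) * E_(m-1)].  As long as [m <= N - L], the
    factor is at most [1 - L / N] and [N / L] is a fixed bound; each later car adds
    at most 1.  The truncated subtraction counts these later cars. *)
Lemma sum_head_size_le (n L : nat) (A : {set 'I_n}) : L <= n.+1 ->
  L * (\sum_(f : {ffun 'I_n -> 'I_n.+1}) head_size f A) <=
  (n.+1 + L * (#|A| + L - n.+1)) * n.+1 ^ n.
Proof.
move=> LN; move: {2}#|A| (erefl #|A|) => m; elim: m A => [|m IH] A cA.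
  have := sum_head_size_rec A; rewrite (cards0_eq cA) big_set0 addn0 leq_mul2l /= cards0.
  move=> le1; have -> : 0 + L - n.+1 = 0 by lia.
  by rewrite muln0 addn0; apply: leq_mul.
rewrite -(@leq_pmul2l n.+1) // mulnCA.
apply: leq_trans (leq_mul (leqnn L) (sum_head_size_rec A)) _.
rewrite mulnDr big_distrr /=.
have le_c c : c \in A -> L * (\sum_(f : {ffun 'I_n -> 'I_n.+1}) head_size f (A :\ c)) <=
    (n.+1 + L * (m + L - n.+1)) * n.+1 ^ n.
  by move=> cin; have := cardsD1 c A; rewrite cin cA => -[E]; rewrite E; apply: IH.
apply: leq_trans (leq_add (leqnn _) (@leq_sum _ _ _ _ _ le_c)) _.
rewrite sum_nat_const cA.
rewrite mulnA (mulnC L) mulnA -mulnDl mulnA leq_mul2r; apply/orP; right.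
have mn : m.+1 <= n.+1 by rewrite -cA (leq_trans (max_card _)) ?card_ord.
have [le_m|gt_m] := leqP (m.+1 + L) n.+1.
  have -> : m.+1 + L - n.+1 = 0 by lia.
  have -> : m + L - n.+1 = 0 by lia.
  nia.
have -> : m.+1 + L - n.+1 = (m + L - n.+1).+1 by lia.
rewrite mulnS addnCA [X in _ <= X]mulnDr leq_add2l.
by rewrite leq_mul.
Qed.

(** * Rotations and the cycle lemma *)

(** The classical criterion for parking functions. *)
Definition parkable (n K : nat) (f : {ffun 'I_n -> 'I_K}) :=
  [forall t : 'I_n.+1, t <= count_below f [set: 'I_n] t].

Lemma parkableP (n K : nat) (f : {ffun 'I_n -> 'I_K}) :
  reflect (forall t, t <= n -> t <= count_below f [set: 'I_n] t) (parkable f).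
Proof.
apply: (iffP forallP) => [H t tn|H t]; last by rewrite H // -ltnS.
by have /= := H (Ordinal (tn : t < n.+1)).
Qed.

(** The cyclic rotation of the spaces [b, ..., K - 1] taking [p] to [b], written
    as the exchange of the intervals from [b] to [p] and from [p] to [K] so that
    no remainder appears. *)
Definition swap_nat (K b p x : nat) : nat :=
  if x < b then x else if x < p then x + (K - p) else x - (p - b).

Lemma swap_nat_lt (K b p x : nat) : b <= p -> p < K -> x < K -> swap_nat K b p x < K.
Proof. rewrite /swap_nat; case: ifP => _ //; case: ifP; lia. Qed.

Lemma swap_nat_inj (K b p x y : nat) : b <= p -> p < K -> x < K -> y < K ->
  swap_nat K b p x = swap_nat K b p y -> x = y.
Proof.
rewrite /swap_nat; case: (ltnP x b) => ?; case: (ltnP y b) => ?;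
  case: (ltnP x p) => ?; case: (ltnP y p) => ?; lia.
Qed.

Definition swap_blocks (n b p : nat) (f : {ffun 'I_n -> 'I_n.+1}) : {ffun 'I_n -> 'I_n.+1} :=
  [ffun c => inord (swap_nat n.+1 b p (f c))].

Lemma swap_blocksE (n b p : nat) (f : {ffun 'I_n -> 'I_n.+1}) c : b <= p -> p < n.+1 ->
  swap_blocks b p f c = swap_nat n.+1 b p (f c) :> nat.
Proof. by move=> bp pn; rewrite ffunE inordK // swap_nat_lt. Qed.

Lemma swap_blocks_inj (n b p : nat) : b <= p -> p < n.+1 ->
  injective (@swap_blocks n b p).
Proof.
move=> bp pn f g /ffunP E; apply/ffunP => c; apply: val_inj => /=.
apply: (@swap_nat_inj n.+1 b p) => //.
by rewrite -!swap_blocksE // E.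
Qed.

Lemma swap_blocks_lt (n b p t : nat) (f : {ffun 'I_n -> 'I_n.+1}) c : b <= p -> p < n.+1 ->
  t <= b -> (swap_blocks b p f c < t) = (f c < t).
Proof.
by move=> bp pn tb; rewrite swap_blocksE // /swap_nat; case: ifP => //; case: ifP; lia.
Qed.

Lemma count_below_swap_head (n b p t : nat) (f : {ffun 'I_n -> 'I_n.+1}) A : b <= p -> p < n.+1 ->
  t <= b -> count_below (swap_blocks b p f) A t = count_below f A t.
Proof.
by move=> bp pn tb; apply: eq_card => c; rewrite !inE swap_blocks_lt.
Qed.

(** Rotation slides a window along the cycle of spaces.  Here the window of
    length [u - p] starting at [p] does not wrap around. *)
Lemma count_below_swap_right (n b p u : nat) (f : {ffun 'I_n -> 'I_n.+1}) A : b <= p -> p < n.+1 ->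
  p <= u -> u <= n.+1 ->
  count_below (swap_blocks b p f) A (b + (u - p)) + count_below f A p =
  count_below f A b + count_below f A u.
Proof.
move=> bp pn pu un; rewrite !count_below_sum -!big_split /=; apply: eq_bigr => c _.
have := ltn_ord (f c); rewrite swap_blocksE // /swap_nat.
by case: (ltnP (f c) b); case: (ltnP (f c) p); lia.
Qed.

(** The case in which the window starting at [p] wraps around and ends at [u]. *)
Lemma count_below_swap_left (n b p u : nat) (f : {ffun 'I_n -> 'I_n.+1}) A : b <= p -> p < n.+1 ->
  b <= u -> u <= p ->
  count_below (swap_blocks b p f) A (u + (n.+1 - p)) + count_below f A p =
  #|A| + count_below f A u.
Proof.
move=> bp pn pu un; rewrite -sum1_card !count_below_sum -!big_split /=; apply: eq_bigr => c _.
have := ltn_ord (f c); rewrite swap_blocksE // /swap_nat.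
by case: (ltnP (f c) b); case: (ltnP (f c) p); lia.
Qed.

(** Consider the walk [h u = count_below f setT u - u].  The first [b] spaces
    receive [b + r - 1] preferences, so that an excess of [r - 1] cars is
    available to fill holes beyond them.  A parkable rotation at [p] therefore
    forbids the walk to fall by [r] after [p], and (next lemma) forces [h p] to
    be a strict record minimum since [b]. *)
Lemma parkable_swap_right (n b p r u : nat) (f : {ffun 'I_n -> 'I_n.+1}) :
  b <= p -> (count_below f [set: 'I_n] b).+1 = b + r ->
  parkable (swap_blocks b p f) -> p <= u -> u < n.+1 ->
  count_below f [set: 'I_n] p + u < count_below f [set: 'I_n] u + r + p.
Proof.
move=> bp Eb /parkableP pk pu un.
have := pk (b + (u - p)) ltac:(lia).
have := @count_below_swap_right n b p u f [set: 'I_n] ltac:(lia) ltac:(lia) ltac:(lia) ltac:(lia).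
lia.
Qed.

Lemma parkable_swap_left (n b p u : nat) (f : {ffun 'I_n -> 'I_n.+1}) :
  p < n.+1 -> parkable (swap_blocks b p f) -> b <= u -> u < p ->
  count_below f [set: 'I_n] p + u < count_below f [set: 'I_n] u + p.
Proof.
move=> pn /parkableP pk bu up.
have := pk (u + (n.+1 - p)) ltac:(lia).
have := @count_below_swap_left n b p u f [set: 'I_n] ltac:(lia) ltac:(lia) ltac:(lia) ltac:(lia).
rewrite cardsT card_ord; lia.
Qed.

(** Pollak's circle argument: the rotation to use starts where the walk
    [h u = count_below f setT u - u] first attains its minimum. *)
Lemma parkable_swap_ex (n : nat) (f : {ffun 'I_n -> 'I_n.+1}) :
  exists p : 'I_n.+1, parkable (swap_blocks 0 p f).
Proof.
pose h u := count_below f [set: 'I_n] u + n - u.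
(* Lexicographic minimum of ([h u], [u]): [u < n.+1] breaks the ties. *)
have [p _ p_min] := @arg_minnP _ ord0 xpredT (fun u : 'I_n.+1 => h u * n.+1 + u) isT.
exists p; apply/parkableP => t tn; have pn := ltn_ord p.
have [le_pt|gt_pt] := leqP (p + t) n.
  have := p_min (Ordinal (le_pt : p + t < n.+1)) isT; rewrite /h /= => le_h.
  have := @count_below_swap_right n 0 p (p + t) f [set: 'I_n] ltac:(lia) pn ltac:(lia) ltac:(lia).
  rewrite add0n addKn => E.
  have : count_below f [set: 'I_n] p + n - p <=
      count_below f [set: 'I_n] (p + t) + n - (p + t) by nia.
  lia.
have un : p + t - n.+1 < n.+1 by lia.
have := p_min (Ordinal un) isT; rewrite /h /= => le_h.
have := @count_below_swap_left n 0 p (p + t - n.+1) f [set: 'I_n] ltac:(lia) pn ltac:(lia) ltac:(lia).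
have -> : p + t - n.+1 + (n.+1 - p) = t by lia.
rewrite cardsT card_ord => E.
have : count_below f [set: 'I_n] p + n - p <
    count_below f [set: 'I_n] (p + t - n.+1) + n - (p + t - n.+1).
  have : p + t - n.+1 < p by lia.
  nia.
lia.
Qed.

(** The upper half of the cycle lemma.  At the parkable starting points the walk
    [h] takes strictly decreasing values, and none of them lies [r] or more below
    the first one. *)
Lemma card_parkable_swap_le (n b r : nat) (f : {ffun 'I_n -> 'I_n.+1}) :
  (count_below f [set: 'I_n] b).+1 = b + r ->
  #|[set p : 'I_n.+1 | (b <= p) && parkable (swap_blocks b p f)]| <= r.
Proof.
move=> Eb; set G := [set p | _].
have [->|[q qG]] := set_0Vmem G; first by rewrite cards0.
have [p0 p0G p0_min] := @arg_minnP _ q (mem G) val qG.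
have GP p : p \in G -> b <= p /\ parkable (swap_blocks b p f) by rewrite inE => /andP.
have [bp0 pk0] := GP _ p0G.
pose g (p : 'I_n.+1) := count_below f [set: 'I_n] p0 + p - (count_below f [set: 'I_n] p + p0).
have decr (p p' : 'I_n.+1) : p \in G -> p' \in G -> p < p' ->
    count_below f [set: 'I_n] p' + p < count_below f [set: 'I_n] p + p'.
  move=> /GP[bp _] /GP[_ pk'] pp'.
  exact: (parkable_swap_left (ltn_ord p') pk' bp pp').
have g_inj : {in G &, injective g}.
  move=> p p' pG p'G; rewrite /g => E; apply: val_inj => /=.
  have := p0_min _ pG; have := p0_min _ p'G => /=.
  have := decr _ _ p0G pG; have := decr _ _ p0G p'G.
  case: (ltngtP p p') => // lt_pp; [have := decr _ _ pG p'G lt_pp|have := decr _ _ p'G pG lt_pp];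
  case: (ltngtP p0 p); case: (ltngtP p0 p') => //; move: E; lia.
have g_lt p : p \in G -> g p < r.
  move=> pG; have := p0_min _ pG => /= p0p.
  have := parkable_swap_right bp0 Eb pk0 p0p (ltn_ord p); rewrite /g.
  by have := parkable_swap_right bp0 Eb pk0 (leqnn p0) (ltn_ord p0); lia.
rewrite cardE -(size_map g) -[X in _ <= X](size_iota 0).
apply: uniq_leq_size.
  rewrite map_inj_in_uniq ?enum_uniq // => p p'; rewrite !mem_enum; apply: g_inj.
by move=> x /mapP[p]; rewrite mem_enum mem_iota => pG ->; rewrite add0n g_lt.
Qed.

(** * Counting parking functions in which a car skips *)

(** Averaging of [parkable_swap_ex] over all rotations. *)
Lemma card_parkable_ge (n : nat) :
  n.+1 ^ n <= n.+1 * #|[set f : {ffun 'I_n -> 'I_n.+1} | parkable f]|.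
Proof.
have -> : n.+1 * #|[set f : {ffun 'I_n -> 'I_n.+1} | parkable f]| =
    \sum_(p < n.+1) \sum_(f : {ffun 'I_n -> 'I_n.+1}) parkable (swap_blocks 0 p f).
  rewrite -[X in X * _](card_ord n.+1) -sum_nat_const; apply: eq_bigr => p _.
  rewrite -(reindex_inj (swap_blocks_inj (leq0n p) (ltn_ord p))
             (P := xpredT) (F := fun f => (parkable f : nat))) /=.
  by rewrite -sum1_card big_mkcond /=; apply: eq_bigr => f _; rewrite inE; case: parkable.
rewrite exchange_big /=.
have -> : n.+1 ^ n = \sum_(f : {ffun 'I_n -> 'I_n.+1}) 1.
  by rewrite sum1_card card_ffun !card_ord.
apply: leq_sum => f _; have [p pk] := parkable_swap_ex f.
by rewrite (bigD1 p) //= pk.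
Qed.

Definition before (n : nat) (i : 'I_n) : {set 'I_n} := [set c : 'I_n | c < i].

(** The preference of [i] lies strictly beyond the first space left free by the
    cars before it: [head_size] is counted from 1, the preference from 0. *)
Definition skipping (n K : nat) (i : 'I_n) : {set {ffun 'I_n -> 'I_K}} :=
  [set f | parkable f & head_size f (before i) <= f i].

Lemma card_before (n : nat) (i : 'I_n) : #|before i| = i.
Proof.
rewrite -sum1_card -(sum_ord_lt (ltnW (ltn_ord i))) big_mkcond /=.
by apply: eq_bigr => c _; rewrite inE; case: ltnP.
Qed.

Lemma card_after (n : nat) (i : 'I_n) : #|[set c : 'I_n | i < c]| = n - i.+1.
Proof.
rewrite -sum1_card -(sum_ord_ge (ltn_ord i)) big_mkcond /=.
by apply: eq_bigr => c _; rewrite inE; case: ltnP.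
Qed.

(** Double counting of the pairs formed by a function and a rotation beyond [b]
    that makes it a parking function in which [i] skips.  Each skipping function
    arises from [n.+1 - b] pairs, and the cycle lemma allows each function at most
    as many rotations as there are later cars preferring one of the first [b]
    spaces.  The factor [n.+1 - b] cancels against the number of preferences
    of [i] outside the first [b] spaces, out of [n.+1]. *)
Lemma skipping_fixed_head (n : nat) (i : 'I_n) (b : nat) :
  n.+1 * #|[set f in @skipping n n.+1 i | head_size f (before i) == b]| <=
  \sum_(c : 'I_n | i < c) \sum_(f : {ffun 'I_n -> 'I_n.+1})
    ((head_size f (before i) == b) && (f c < b)).
Proof.
set S := [set f in _ | _].
have [b_le|b_gt] := leqP b n; last first.
  suff -> : S = finset.set0 by rewrite cards0 muln0.
  apply/setP => f; rewrite !inE; apply/negP => /andP[/andP[_ le_fi] /eqP E].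
  by have := head_size_le_card f (before i); rewrite card_before E; have := ltn_ord i; lia.
pose F (f : {ffun 'I_n -> 'I_n.+1}) := (head_size f (before i) == b) && (b <= f i).
have bn1 : 0 < n.+1 - b by rewrite subn_gt0 ltnS.
(* [F f]: the property of being in [S] apart from parkability, invariant under
   rotation beyond [b]. *)
have step1 : (n.+1 - b) * #|S| <=
    \sum_(f | F f) \sum_(c : 'I_n | i < c) (f c < b).
  have -> : (n.+1 - b) * #|S| =
      \sum_(p < n.+1 | b <= p) \sum_(f : {ffun 'I_n -> 'I_n.+1}) (swap_blocks b p f \in S).
    have -> : n.+1 - b = \sum_(p < n.+1 | b <= p) 1.
      by rewrite -(sum_ord_ge (leqW b_le)) [RHS]big_mkcond; apply: eq_bigr => p _; case: leqP.
    rewrite big_distrl /=; apply: eq_bigr => p bp; rewrite mul1n.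
    rewrite -(reindex_inj (swap_blocks_inj bp (ltn_ord p))
               (P := xpredT) (F := fun f => (f \in S : nat))) /=.
    by rewrite -sum1_card big_mkcond /=; apply: eq_bigr => f _; case: (f \in S).
  rewrite exchange_big /= [X in _ <= X]big_mkcond /=; apply: leq_sum => f _.
  have swapS (p : 'I_n.+1) : b <= p -> swap_blocks b p f \in S ->
      F f && parkable (swap_blocks b p f).
    move=> bp; have pn := ltn_ord p; rewrite !inE => /andP[/andP[-> fi] hb]; rewrite andbT /F.
    rewrite -(@head_size_local _ _ (swap_blocks b p f) f (before i)); last first.
      by move=> t tb; rewrite count_below_swap_head.
    by rewrite hb /= leqNgt -(@swap_blocks_lt n b p b) // -leqNgt -[X in X <= _](eqP hb).
  case: ifP => [Ff|nF]; last first.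
    by rewrite big1 // => p /swapS; rewrite nF; case: (swap_blocks b p f \in S) => // /(_ isT).
  have /andP[/eqP hb fi] := Ff.
  (* The cars preferring a space of the head are [b - 1] cars before [i], not [i]
     itself, and [r] cars after it. *)
  have Eb : (count_below f [set: 'I_n] b).+1 = b + \sum_(c : 'I_n | i < c) (f c < b).
    have := count_below_head_size f (before i); rewrite hb => {2}<-.
    rewrite !count_below_sum addSn; congr _.+1.
    rewrite (bigID (mem (before i))) /=; congr addn; first by apply: eq_bigl => c; rewrite inE.
    rewrite (bigD1 i) /=; last by rewrite !inE ltnn.
    rewrite ltnNge fi /= add0n; apply: eq_bigl => c; rewrite !inE -leqNgt.
    by rewrite ltn_neqAle eq_sym andbC.
  apply: leq_trans (card_parkable_swap_le Eb).
  rewrite -sum1_card big_mkcond [X in _ <= X]big_mkcond /=; apply: leq_sum => p _.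
  case: ifP => // bp; have [/(swapS p bp)/andP[_ pk]|//] := boolP (swap_blocks b p f \in S).
  by rewrite inE bp pk.
rewrite -(leq_pmul2l bn1) mulnCA.
apply: leq_trans (leq_mul (leqnn _) step1) _.
rewrite exchange_big /= !big_distrr /=; apply: leq_sum => c ic.
have iB : i \notin before i by rewrite inE ltnn.
have ci : c == i = false by apply/negP => /eqP E; rewrite E ltnn in ic.
have := @sum_resample _ 'I_n.+1 i (fun f v => [&& head_size f (before i) == b, b <= v & f c < b] : nat).
rewrite card_ord => E.
rewrite big_mkcond /= (eq_bigr (fun f : {ffun 'I_n -> 'I_n.+1} =>
   [&& head_size f (before i) == b, b <= f i & f c < b] : nat)); last first.
  by move=> f _; rewrite /F; case: (_ == b); case: (b <= f i); case: (f c < b).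
rewrite E; last by move=> f v w; rewrite head_size_redraw // ffunE ci.
rewrite big_distrr /=; apply: leq_sum => f _.
rewrite -(sum_ord_ge (leqW b_le)) big_distrl /=; apply: leq_sum => v _.
by case: (_ == b); case: (b <= v); case: (f c < b).
Qed.

(** Sum of [skipping_fixed_head] over [b]: the event that a later car prefers a
    space up to the first free one turns into the mean head size by independence
    of that car's preference. *)
Lemma card_skipping_le (n : nat) (i : 'I_n) :
  n.+1 * (n.+1 * #|@skipping n n.+1 i|) <=
  (n - i.+1) * \sum_(f : {ffun 'I_n -> 'I_n.+1}) head_size f (before i).
Proof.
have split_head (f : {ffun 'I_n -> 'I_n.+1}) (P : nat -> bool) :
    \sum_(b < n.+2) ((head_size f (before i) == b) && P b) = P (head_size f (before i)).
  have lt_h : head_size f (before i) < n.+2.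
    by have := head_size_le_card f (before i); rewrite card_before; have := ltn_ord i; lia.
  rewrite (bigD1 (Ordinal lt_h)) //= eqxx big1 ?addn0 // => b.
  by rewrite -val_eqE /= eq_sym => /negPf ->.
have -> : #|@skipping n n.+1 i| =
    \sum_(b < n.+2) #|[set f in @skipping n n.+1 i | head_size f (before i) == b]|.
  rewrite -sum1_card big_mkcond /=.
  rewrite (eq_bigr (fun f : {ffun 'I_n -> 'I_n.+1} =>
    \sum_(b < n.+2) ((head_size f (before i) == b) && (f \in skipping n.+1 i)))) => [|f _].
    rewrite exchange_big /=; apply: eq_bigr => b _.
    rewrite -sum1_card [RHS]big_mkcond; apply: eq_bigr => f _.
    by rewrite [in RHS]inE andbC; case: (_ && _).
  by rewrite (split_head f (fun=> f \in skipping n.+1 i)); case: (f \in _).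
have /leq_trans -> // : n.+1 * (n.+1 * \sum_(b < n.+2)
      #|[set f in @skipping n n.+1 i | head_size f (before i) == b]|) <=
    n.+1 * \sum_(c : 'I_n | i < c) \sum_(f : {ffun 'I_n -> 'I_n.+1})
      (f c < head_size f (before i)).
  rewrite leq_mul2l /= big_distrr /=.
  apply: leq_trans; first by apply: leq_sum => b _; exact: skipping_fixed_head.
  rewrite exchange_big /=; apply: leq_sum => c _.
  rewrite exchange_big /=; apply: leq_sum => f _.
  by rewrite (split_head f (fun b => f c < b)).
rewrite big_distrr /= (eq_bigr (fun=> \sum_(f : {ffun 'I_n -> 'I_n.+1}) head_size f (before i))) =>
  [|c ic]; last by rewrite sum_lt_head_size // inE -leqNgt ltnW.
rewrite sum_nat_const leq_mul2r; apply/orP; right.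
by rewrite -card_after cardsE.
Qed.

(** * The parking process *)

Lemma space_forP (n : nat) (occ : occupancy n) (p : 'I_n) :
  match space_for occ p with
  | Some q => [/\ p <= q, occ q = None &
      forall r : 'I_n, p <= r -> occ r = None -> q <= r]
  | None => forall r : 'I_n, p <= r -> occ r <> None
  end.
Proof.
rewrite /space_for; case: eqP => [occp //|/eqP occp].
pose free := [seq q : 'I_n <- enum 'I_n | (p < q) && (occ q == None)].
have freeP (r : 'I_n) : p <= r -> occ r = None -> r \in free.
  move=> pr occr; rewrite mem_filter mem_enum andbT occr eqxx andbT ltn_neqAle pr andbT.
  by apply/eqP => /val_inj E; rewrite E occr in occp.
have : sorted (relpre val ltn) free.
  apply: sorted_filter; first by move=> a b c; apply: ltn_trans.
  by rewrite -sorted_map val_enum_ord iota_ltn_sorted.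
have free_sub r : r \in free -> p < r /\ occ r = None.
  by rewrite mem_filter => /andP[/andP[? /eqP]].
rewrite -/free; case: free freeP free_sub => [|q free] /= freeP free_sub.
  by move=> _ r pr occr; have := freeP r pr occr.
move=> /(order_path_min (fun a b c => @ltn_trans _ _ _))/allP q_min.
have [/ltnW pq occq] := free_sub q (mem_head _ _); split=> // r pr occr.
by have := freeP r pr occr; rewrite inE => /predU1P[->//|/q_min/ltnW].
Qed.

Definition street_at (n : nat) (pref : {ffun 'I_n -> 'I_n}) (m : nat) : occupancy n :=
  foldl (park_car pref) [ffun=> None] (take m (enum 'I_n)).

Lemma street_at0 (n : nat) (pref : {ffun 'I_n -> 'I_n}) : street_at pref 0 = [ffun=> None].
Proof. by rewrite /street_at take0. Qed.

Lemma street_atS (n : nat) (pref : {ffun 'I_n -> 'I_n}) (i : 'I_n) :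
  street_at pref i.+1 = park_car pref (street_at pref i) i.
Proof.
rewrite /street_at (take_nth i) ?size_enum_ord // nth_ord_enum.
by rewrite -cats1 foldl_cat.
Qed.

Lemma street_at_final (n : nat) (pref : {ffun 'I_n -> 'I_n}) :
  street_at pref n = final_occupancy pref.
Proof. by rewrite /street_at take_oversize ?size_enum_ord. Qed.

Lemma park_car_persist (n : nat) (pref : {ffun 'I_n -> 'I_n}) (occ : occupancy n) i r c :
  occ r = Some c -> park_car pref occ i r = Some c.
Proof.
rewrite /park_car; have := space_forP occ (pref i); case: space_for => // q [_ occq _] occr.
by rewrite ffunE; case: eqP => // E; rewrite E occq in occr.
Qed.

Lemma street_at_persist (n : nat) (pref : {ffun 'I_n -> 'I_n}) (m m' : nat) r c :
  m <= m' <= n -> street_at pref m r = Some c -> street_at pref m' r = Some c.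
Proof.
case/andP; elim: m' => [|m' IH]; first by rewrite leqn0 => /eqP ->.
rewrite leq_eqVlt => /predU1P[-> //|mm'] m'n /(IH mm' (ltnW m'n)) H.
by rewrite (street_atS pref (Ordinal m'n)); apply: park_car_persist.
Qed.

(** The last clause covers parked cars and cars that left: a car whose preference
    is at most a free space cannot have driven past that space. *)
Definition consistent (n : nat) (pref : {ffun 'I_n -> 'I_n}) (m : nat) (occ : occupancy n) :=
  [/\ forall r c, occ r = Some c -> c < m /\ pref c <= r,
      forall r r' c, occ r = Some c -> occ r' = Some c -> r = r' &
      forall (c q : 'I_n), c < m -> pref c <= q -> occ q = None ->
        exists2 r : 'I_n, r < q & occ r = Some c].

Lemma consistent_street (n : nat) (pref : {ffun 'I_n -> 'I_n}) (m : nat) :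
  m <= n -> consistent pref m (street_at pref m).
Proof.
elim: m => [_|m IH mn].
  by rewrite street_at0; split=> [r c|r r' c|//]; rewrite ffunE.
have [down inj full] := IH (ltnW mn).
pose i := Ordinal mn; rewrite (street_atS pref i).
set occ := street_at pref m in down inj full *.
rewrite /park_car.
have := space_forP occ (pref i); case: space_for => [q [pq occq q_min]|all_occ]; last first.
  split=> // [r c /down[cm ->]|c q cm pc occq]; first by split=> //; apply: ltnW.
  move: cm; rewrite ltnS leq_eqVlt => /predU1P[cm|/full]; last exact.
  have ci : c = i by apply: val_inj.
  by rewrite ci in pc; case: (all_occ q pc).
split=> [r c|r r' c|c q' cm pc].
- rewrite ffunE; case: eqP => [-> [<-]//|_ /down[cm ->]]; split=> //; exact: ltnW.
- rewrite !ffunE; case: eqP => [->|_]; case: eqP => [->|_] //; last exact: inj.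
    by move=> [<-] /down[]; rewrite ltnn.
  by move=> /down[+ _] [E]; rewrite -E ltnn.
- rewrite ffunE; case: eqP => // /eqP q'q occq'.
  move: cm; rewrite ltnS leq_eqVlt => /predU1P[cm|cm].
    have ci : c = i by apply: val_inj.
    exists q; last by rewrite ffunE eqxx ci.
    by rewrite ltn_neqAle eq_sym q'q q_min // -ci.
  have [r rq occr] := full c q' cm pc occq'; exists r => //.
  by rewrite ffunE; case: eqP => // E; rewrite E occq in occr.
Qed.

(** The cars preferring a space up to a free space [q] have parked injectively
    among the [q] spaces before it. *)
Lemma count_below_free (n : nat) (pref : {ffun 'I_n -> 'I_n}) (m : nat) (q : 'I_n) :
  m <= n -> street_at pref m q = None ->
  count_below pref [set c : 'I_n | c < m] q.+1 <= q.
Proof.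
move=> mn occq; have [_ _ full] := consistent_street pref mn.
pose cars := [set c : 'I_n in [set c : 'I_n | c < m] | pref c < q.+1].
pose space (c : 'I_n) := odflt q [pick r : 'I_n | (r < q) && (street_at pref m r == Some c)].
have spaceP c : c \in cars -> space c < q /\ street_at pref m (space c) = Some c.
  rewrite !inE => /andP[cm pc]; rewrite /space; case: pickP => [r /andP[? /eqP]//|none].
  have [r rq occr] := full c q cm pc occq.
  by have := none r; rewrite rq occr eqxx.
rewrite /count_below -/cars -(card_in_imset (f := space)) => [|c d cin din E]; last first.
  by have [_] := spaceP c cin; rewrite E; have [_ ->] := spaceP d din; case.
rewrite -[X in _ <= X](sum_ord_lt (ltnW (ltn_ord q))) -sum1_card big_mkcond /=.
apply: leq_sum => r _; case: ifP => // /imsetP[c cin ->].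
by have [-> _] := spaceP c cin.
Qed.

(** If all cars park, the cars in the first [t] spaces prefer one of these
    spaces.  Conversely a space that remained free would violate the count by
    [count_below_free]; so all spaces, hence all cars, are matched. *)
Lemma parking_functionE (n : nat) (pref : {ffun 'I_n -> 'I_n}) :
  (pref \in parking_functions n) = parkable pref.
Proof.
have [down inj full] := consistent_street pref (leqnn n).
apply/idP/parkableP => [pk t tn|pk].
  have [s /forallP s_out] := parking_outcome_ex pk.
  rewrite -[X in X <= _](sum_ord_lt tn) count_below_sum.
  rewrite [X in _ <= X](eq_bigl xpredT) => [|c]; last by rewrite inE.
  rewrite [X in _ <= X](reindex_inj (@perm_inj _ s)) /=.
  apply: leq_sum => q _; have := down q (s q); rewrite street_at_final.
  move=> /(_ (eqP (s_out q)))[_ le_q].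
  by case: (ltnP q t) => // qt; rewrite (leq_ltn_trans le_q qt).
(* A free space would contradict the count at the next threshold. *)
have occupied q : street_at pref n q != None.
  apply/eqP => /(count_below_free (leqnn n)).
  have -> : [set c : 'I_n | c < n] = [set: 'I_n] by apply/setP => c; rewrite !inE ltn_ord.
  by rewrite leqNgt pk.
pose car q := odflt q (street_at pref n q).
have carP q : street_at pref n q = Some (car q) by rewrite /car; case: (street_at pref n q) (occupied q).
have car_inj : injective car by move=> q r E; apply: (inj _ _ (car q)); rewrite ?carP ?E.
rewrite inE; apply/forallP => i; apply/existsP; exists (invF car_inj i).
by rewrite -street_at_final carP f_invF.
Qed.

(** Every space free when [k] arrives lies at or beyond the first free one, so
    the preference of [k] is at most the final space of [l].  That space is still
    free after [k] has parked, hence [k] stands to its left. *)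
Lemma park_left_of_next (n : nat) (pref : {ffun 'I_n -> 'I_n}) (s : 'S_n) (k l : 'I_n) :
  (forall q, final_occupancy pref q = Some (s q)) -> l = k.+1 :> nat ->
  pref k < head_size pref (before k) -> (s^-1 k)%g < (s^-1 l)%g.
Proof.
move=> out lk pk.
have final_inj (m : nat) (r c : 'I_n) : m <= n -> street_at pref m r = Some c -> s r = c.
  move=> mn occ; have mnn : m <= n <= n by rewrite mn leqnn.
  by have := street_at_persist mnn occ; rewrite street_at_final out => -[].
have [_ _ full] := consistent_street pref (ltn_ord k).
have kn := ltn_ord k; have ln := ltn_ord l.
pose q := (s^-1 l)%g; have sq : s q = l by rewrite permKV.
have free m : m <= l -> street_at pref m q = None.
  move=> ml; case occ: (street_at pref m q) => [c|//].
  have mn : m <= n := leq_trans ml (ltnW ln).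
  have [+ _ _] := consistent_street pref mn => /(_ _ _ occ)[cm _].
  by have := final_inj _ _ _ mn occ; rewrite sq => E; rewrite -E ltnNge ml in cm.
have head_q : head_size pref (before k) <= q.+1.
  by apply: head_size_le; rewrite ltnS count_below_free // ?free ?lk // ltnW.
have [r rq occr] : exists2 r : 'I_n, r < q & street_at pref k.+1 r = Some k.
  by apply: full => //; [rewrite -ltnS (leq_trans pk) | rewrite free ?lk].
by rewrite -(final_inj _ _ _ kn occr) permK.
Qed.

(** * From street preferences to the street with an overflow space *)

Definition widen_pref (n : nat) (f : {ffun 'I_n -> 'I_n}) : {ffun 'I_n -> 'I_n.+1} :=
  [ffun c => widen_ord (leqnSn n) (f c)].

Lemma widen_pref_inj (n : nat) : injective (@widen_pref n).
Proof.
move=> f g /ffunP E; apply/ffunP => c; apply: val_inj.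
by have /(congr1 val) := E c; rewrite !ffunE.
Qed.

Lemma count_below_widen (n t : nat) (f : {ffun 'I_n -> 'I_n}) A :
  count_below (widen_pref f) A t = count_below f A t.
Proof. by apply: eq_card => c; rewrite !inE ffunE. Qed.

Lemma parkable_widen (n : nat) (f : {ffun 'I_n -> 'I_n}) :
  parkable (widen_pref f) = parkable f.
Proof. by apply: eq_forallb => t; rewrite count_below_widen. Qed.

Lemma head_size_widen (n : nat) (f : {ffun 'I_n -> 'I_n}) A :
  head_size (widen_pref f) A = head_size f A.
Proof.
apply/eqP; apply/head_sizeP; rewrite count_below_widen.
have /head_sizeP[? H] := eqxx (head_size f A).
by split=> // t; rewrite count_below_widen; apply: H.
Qed.

(** A parkable function never uses the overflow space, since all [n] preferences
    lie below [n]. *)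
Lemma card_parking_functions_ge (n : nat) : n.+1 ^ n <= n.+1 * #|parking_functions n|.
Proof.
apply: leq_trans (card_parkable_ge n) _; rewrite leq_mul2l /=.
rewrite -(card_imset _ (@widen_pref_inj n)).
apply/subset_leq_card/fintype.subsetP => f; rewrite inE => pk.
have all_lt c : f c < n.
  have /parkableP/(_ n (leqnn n)) := pk => le_n.
  have /eqP/setP/(_ c) : [set c in [set: 'I_n] | f c < n] == [set: 'I_n].
    by rewrite eqEcard finset.subsetT cardsT card_ord.
  by rewrite !inE.
pose g : {ffun 'I_n -> 'I_n} := [ffun c => Ordinal (all_lt c)].
have fg : f = widen_pref g by apply/ffunP => c; apply: val_inj; rewrite !ffunE.
by apply/imsetP; exists g => //; rewrite parking_functionE -parkable_widen -fg.
Qed.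

Lemma card_skipping_widen (n : nat) (i : 'I_n) : #|@skipping n n i| <= #|@skipping n n.+1 i|.
Proof.
rewrite -(card_imset _ (@widen_pref_inj n)); apply/subset_leq_card/fintype.subsetP => _ /imsetP[f + ->].
by rewrite !inE parkable_widen head_size_widen ffunE.
Qed.

Lemma card_bigcup_le (I T : finType) (P : pred I) (F : I -> {set T}) :
  #|\bigcup_(i | P i) F i| <= \sum_(i | P i) #|F i|.
Proof.
elim/big_rec2: _ => [|i A m _ le_Am]; first by rewrite cards0.
by apply: leq_trans (leq_card_setU _ _).1 _; rewrite leq_add2l.
Qed.

Definition late_skipping (n j : nat) : {set {ffun 'I_n -> 'I_n}} :=
  \bigcup_(i : 'I_n | n - j <= i) skipping n i.

(** Each of the last [j] cars has fewer than [j] cars after it, and the number of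
    all functions is at most [n.+1] times the number of parking functions. *)
Lemma card_late_skipping (n j L : nat) : L <= n.+1 ->
  L * n.+1 * #|late_skipping n j| <= j * j * (n.+1 + L * L) * #|parking_functions n|.
Proof.
move=> LN.
have skip_le (i : 'I_n) : n - j <= i ->
    n.+1 * (n.+1 * (L * #|@skipping n n i|)) <= j * ((n.+1 + L * L) * n.+1 ^ n).
  move=> ji.
  apply: (@leq_trans (L * (n.+1 * (n.+1 * #|@skipping n n.+1 i|)))).
    by rewrite !(mulnCA L) !leq_mul2l card_skipping_widen !orbT.
  apply: leq_trans (leq_mul (leqnn L) (card_skipping_le i)) _.
  rewrite mulnCA; apply: leq_mul; first lia.
  apply: leq_trans (sum_head_size_le (before i) LN) _.
  rewrite leq_mul2r leq_add2l leq_mul2l card_before; apply/orP; right; apply/orP; right.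
  by have := ltn_ord i; lia.
rewrite -(@leq_pmul2l n.+1) //.
apply: (@leq_trans (j * (j * ((n.+1 + L * L) * n.+1 ^ n)))); last first.
  have := card_parking_functions_ge n; move: (n.+1 ^ n) #|_| (n.+1 + L * L) => a b c ab.
  by rewrite -!mulnA !(mulnCA n.+1) !leq_mul2l ab !orbT.
apply: (@leq_trans (\sum_(i : 'I_n | n - j <= i) n.+1 * (n.+1 * (L * #|@skipping n n i|)))).
  rewrite -!big_distrr /= mulnA (mulnC L) -!mulnA !leq_mul2l /=.
  by rewrite card_bigcup_le orbT.
apply: leq_trans; first by apply: leq_sum => i; apply: skip_le.
rewrite sum_nat_const leq_mul2r; apply/orP; right.
rewrite -sum1_card big_mkcond.
apply: (@leq_trans (\sum_(i < n) (n - j <= i))).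
  by apply: leq_sum => i _; rewrite -[i \in _]/(n - j <= i); case: (n - j <= i).
by rewrite sum_ord_ge; lia.
Qed.

Lemma not_increasing_skipping (n j : nat)
    (pref : {pref : {ffun 'I_n -> 'I_n} | pref \in parking_functions n}) :
  parking_outcome pref \notin last_cars_increasing n j -> val pref \in late_skipping n j.
Proof.
rewrite inE negb_forall => /existsP[k]; rewrite negb_forall => /existsP[l].
rewrite negb_imply => /andP[/andP[jk /eqP lk]] not_lt.
apply/bigcupP; exists k => //; rewrite inE -parking_functionE (valP pref) /= leqNgt.
by apply: contra not_lt; apply: park_left_of_next lk; apply: parking_outcomeP.
Qed.

Lemma card_increasing_ge (n j : nat) :
  #|parking_functions n| <=
  #|@parking_outcome n @^-1: last_cars_increasing n j| + #|late_skipping n j|.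
Proof.
have -> : #|parking_functions n| =
    #|{: {pref : {ffun 'I_n -> 'I_n} | pref \in parking_functions n}}|.
  by rewrite card_sig.
rewrite -(cardsC (@parking_outcome n @^-1: last_cars_increasing n j)) leq_add2l.
rewrite -(card_imset _ val_inj).
apply/subset_leq_card/fintype.subsetP => _ /imsetP[pref + ->].
by rewrite !finset.in_setC finset.in_set; apply: not_increasing_skipping.
Qed.

(** * The probability that the last cars park in increasing order *)

Local Open Scope classical_set_scope.
Local Open Scope ring_scope.

Lemma park_probE (R : realType) (n : nat) (A : {set 'S_n}) :
  park_prob R A = #|@parking_outcome n @^-1: A|%:R / #|parking_functions n|%:R.
Proof.
rewrite /park_prob /park_mass -big_distrl /= -natr_sum; congr (_%:R / _).
rewrite -sum1_card (partition_big (@parking_outcome n) (mem A)) => [|x]; last by rewrite inE.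
apply: eq_bigr => s sA; rewrite -sum1_card; apply: eq_bigl => x.
by rewrite !inE; case: eqP => [->|]; rewrite ?andbF // andbT; exact/esym.
Qed.

Lemma park_prob_last_cars_bounds (R : realType) (n j L : nat) :
  (0 < L <= n.+1)%N ->
  0 <= 1 - park_prob R (last_cars_increasing n j) <=
    j%:R ^+ 2 * (n.+1%:R + L%:R ^+ 2) / (L%:R * n.+1%:R).
Proof.
move=> /andP[L0 LN].
have pf_gt0 : (0 < #|parking_functions n|)%N.
  have := card_parking_functions_ge n; rewrite -[X in (X <= _)%N -> _]prednK ?expn_gt0 //.
  by case: #|_| => //; rewrite muln0.
have pf_gt0R : 0 < #|parking_functions n|%:R :> R by rewrite ltr0n.
rewrite park_probE; apply/andP; split.
  rewrite subr_ge0 ler_pdivrMr // mul1r ler_nat.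
  rewrite -(card_sig (mem (parking_functions n))); exact: max_card.
apply: (@le_trans _ _ (#|late_skipping n j|%:R / #|parking_functions n|%:R)).
  rewrite lerBlDr -mulrDl ler_pdivlMr // mul1r -natrD ler_nat addnC.
  exact: card_increasing_ge.
rewrite ler_pdivrMr // mulrAC ler_pdivlMr ?mulr_gt0 ?ltr0n //.
rewrite mulrC !expr2 -!natrM -natrD -!natrM ler_nat.
exact: card_late_skipping.
Qed.

Theorem theorem4 (R : realType) (j : nat -> nat)
    (j_bounds : forall n : nat, (1 <= n)%N -> (1 <= j n <= n)%N)
    (j_small : (fun n : nat => (j n)%:R : R^o) =o_\oo
               (fun n : nat => (n%:R : R) `^ (6%:R^-1) : R^o)) :
  (fun n : nat => park_prob R (last_cars_increasing n (j n))) @ \oo --> (1 : R).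
Proof.
apply/cvgrPdist_le => eps eps_gt0.
(* [d <= 1] lets [d ^+ 2] be replaced by [d]; the factor 4 is the product of the
   losses [x ^+ 3 <= 2 * L] and [n.+1 + L ^+ 2 <= 2 * n.+1]. *)
pose d : R := Num.min 1 (eps / 4%:R).
have d_gt0 : 0 < d by rewrite lt_min ltr01 divr_gt0 // ltr0n.
have /eqoP/(_ d d_gt0) j_le := j_small.
near=> n.
have n_ge1 : (1 <= n)%N by near: n; exact: nbhs_infty_ge.
have : `|(j n)%:R : R^o| <= d * `|(n%:R : R) `^ (6%:R^-1) : R^o| by near: n.
pose x : R := (n%:R : R) `^ (6%:R^-1).
rewrite [`|_|]ger0_norm ?ler0n // [`|_|]ger0_norm ?powR_ge0 // -/x => j_le_x.
have x6 : x ^+ 6 = n%:R.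
  by rewrite -powR_mulrn ?powR_ge0 // /x -powRrM mulVf ?pnatr_eq0 // powRr1.
have x_ge1 : 1 <= x by rewrite -(@expr_ge1 _ 6%N) ?powR_ge0 // x6 ler1n.
(* [L] is the integral part of the square root of [n = x ^+ 6]. *)
pose L := Num.truncn (x ^+ 3).
have x3_ge1 : 1 <= x ^+ 3 by rewrite exprn_ege1.
have /andP[L_le L_gt] : L%:R <= x ^+ 3 < L.+1%:R.
  by apply: truncn_itv; apply: le_trans x3_ge1.
have L_gt0 : (0 < L)%N by rewrite -ltnS -(ltr_nat R) (le_lt_trans x3_ge1).
have LN : (0 < L <= n.+1)%N.
  rewrite L_gt0 /= -(ler_nat R) (le_trans L_le) // -natr1 -x6.
  nra.
have /andP[diff_ge0 diff_le] := @park_prob_last_cars_bounds R n (j n) L LN.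
rewrite ger0_norm //; apply: le_trans diff_le _.
rewrite ler_pdivrMr ?mulr_gt0 ?ltr0n //.
have d_le : 4%:R * d <= eps.
  by rewrite mulrC -ler_pdivlMr ?ltr0n // /d ge_min lexx orbT.
have d_le1 : d <= 1 by rewrite /d ge_min lexx.
have j2_le : (j n)%:R ^+ 2 <= d * x ^+ 2.
  apply: (@le_trans _ _ ((d * x) ^+ 2)).
    by rewrite ler_pXn2r ?nnegrE ?ler0n // mulr_ge0 ?ltW // (lt_le_trans ltr01).
  by rewrite exprMn ler_wpM2r ?sqr_ge0 // expr2 ler_piMl // ltW.
have x2_le : x ^+ 2 <= 2%:R * L%:R.
  apply: (@le_trans _ _ (x ^+ 3)); first by rewrite ler_weXn2l.
  apply: (le_trans (ltW L_gt)); rewrite mulr_natl mulr2n -natr1 lerD2l.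
  by rewrite ler1n.
have N_le : n.+1%:R + L%:R ^+ 2 <= 2%:R * n.+1%:R :> R.
  rewrite mulr_natl mulr2n lerD2l -natr1 -x6 -[6%N]/(3 * 2)%N exprM.
  apply: (@le_trans _ _ ((x ^+ 3) ^+ 2)); last by rewrite lerDl.
  by rewrite ler_pXn2r ?nnegrE ?ler0n // (le_trans ler01).
apply: (@le_trans _ _ ((d * x ^+ 2) * (2%:R * n.+1%:R))).
  by apply: ler_pM => //; rewrite ?addr_ge0 ?sqr_ge0.
apply: (@le_trans _ _ ((d * (2%:R * L%:R)) * (2%:R * n.+1%:R))).
  by rewrite ler_wpM2r ?mulr_ge0 // ler_wpM2l // ltW.
have -> : d * (2%:R * L%:R) * (2%:R * n.+1%:R) = 4%:R * d * (L%:R * n.+1%:R) by ring.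
by rewrite ler_wpM2r ?mulr_ge0.
Unshelve. all: by end_near.
Qed.
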